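(* For every integer $n\geq 1$, the number of absolutely symmetric rooted trees with $n$ edges (counted up to isomorphism of rooted trees) equals $T(n)$.
   Context: For a vector $A=(a_1,\ldots,a_k)$, $k\geq 1$, of positive integers define $f(A)$ recursively by $f(a_1)=a_1$ and $f(a_1,\ldots,a_{i+1})=(f(a_1,\ldots,a_i)+1)\,a_{i+1}$. For a positive integer $n$, the complexity $T(n)$ is the number of vectors $A$ (of any length $k\geq1$, with positive integer entries) such that $f(A)=n$. A rooted tree is called absolutely symmetric if it has exactly one plane (flat) realization, i.e. there is no plane rooted tree isomorphic to it (as a rooted tree) that is distinct from it as a plane rooted tree; equivalently, for every vertex $v$, the subtrees rooted at the children of $v$ are pairwise isomorphic as rooted trees. *)

(* Defs.v *)
From mathcomp Require Import all_boot.

Set Implicit Arguments.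
Unset Strict Implicit.
Unset Printing Implicit Defensive.

(* The empty vector is excluded wherever [vec_val] is used; its value is junk. *)
Definition vec_val (A : seq nat) : nat :=
  if A is a :: s then foldl (fun m b => m.+1 * b) a s else 0.

(* The bounds on length and entries are harmless: see [vec_bounds]. *)
Definition complexity (n : nat) : nat :=
  \sum_(1 <= k < n.+1)
    #|[set A : k.-tuple 'I_n.+1 |
        all (fun a : 'I_n.+1 => 0 < a) A
        && (vec_val [seq val a | a : 'I_n.+1 <- A] == n)]|.

Lemma vec_bounds (A : seq nat) :
  all (fun a => 0 < a) A ->
  size A <= vec_val A /\ all (fun a => a <= vec_val A) A.
Proof.
case: A => [|a s] //= /andP[a_gt0 s_gt0].
suff main : forall m, m + size s <= foldl (fun m b => m.+1 * b) m s
    /\ all (fun b => b <= foldl (fun m b => m.+1 * b) m s) s.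
  have [le_sz le_s] := main a; split.
    by apply: leq_trans le_sz; rewrite -add1n leq_add2r.
  by rewrite le_s andbT (leq_trans (leq_addr _ _) le_sz).
elim: s s_gt0 {a a_gt0} => [_ m|b s IHs /= /andP[b_gt0 s_gt0] m].
  by rewrite addn0.
have [le_sz le_s] := IHs s_gt0 (m.+1 * b); split.
  apply: leq_trans le_sz; rewrite addnS -addSn leq_add2r.
  by rewrite leq_pmulr.
rewrite le_s andbT; apply: leq_trans le_sz.
by apply: leq_trans (leq_addr _ _); rewrite leq_pmull.
Qed.

Record rooted_graph := RootedGraph {
  gvertex : finType;
  groot : gvertex;
  gadj : rel gvertex
}.

(* Any two vertices of a tree are joined by exactly one simple path;
   [p] lists the vertices of the path after its origin [x]. *)
Definition rooted_tree (G : rooted_graph) : Prop :=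
  [/\ symmetric (@gadj G), irreflexive (@gadj G) &
      forall x y : gvertex G, exists! p : seq (gvertex G),
        [/\ path (@gadj G) x p, uniq (x :: p) & last x p = y]].

Definition num_edges (G : rooted_graph) : nat :=
  #|[set [set p.1; p.2] | p : gvertex G * gvertex G & gadj p.1 p.2]|.

Definition rooted_iso (G H : rooted_graph) : Prop :=
  exists f : gvertex G -> gvertex H,
    [/\ bijective f, f (groot G) = groot H & {mono f : x y / gadj x y}].

(* A plane rooted tree is given by the ordered list of the plane trees hanging
   from its root, so distinct plane rooted trees are distinct terms. *)
Inductive plane_tree := PNode of seq plane_tree.

(* Vertices are named by their access paths: the root is [::], and the i-th
   child (from 0) of the vertex a is rcons a i. *)
Fixpoint addresses (t : plane_tree) : seq (seq nat) :=
  let: PNode ts := t in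
  [::] :: flatten [seq [seq ia.1 :: b | b <- ia.2]
                  | ia <- zip (iota 0 (size ts)) (map addresses ts)].

Lemma root_address (t : plane_tree) : [::] \in addresses t.
Proof. by case: t => ts; rewrite mem_head. Qed.

Definition is_child (a b : seq nat) : bool :=
  prefix a b && (size b == (size a).+1).

Definition underlying (t : plane_tree) : rooted_graph :=
  @RootedGraph (seq_sub (addresses t)) (SeqSub (root_address t))
    (fun a b => is_child (val a) (val b) || is_child (val b) (val a)).

Definition absolutely_symmetric (G : rooted_graph) : Prop :=
  exists! t : plane_tree, rooted_iso (underlying t) G.

(* P holds for exactly N objects up to the equivalence E: some N pairwise
   inequivalent objects represent all those satisfying P. *)
Definition count_upto (X : Type) (E : X -> X -> Prop) (P : X -> Prop)
    (N : nat) : Prop :=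
  exists r : 'I_N -> X,
    [/\ forall i, P (r i),
        forall i j, E (r i) (r j) -> i = j &
        forall x, P x -> exists i, E x (r i)].

(* Main.v *)
(* Rotating the list of children, or replacing a subtree by another realization
   of it, does not change the rooted tree.  So if a plane tree is the only
   realization of its rooted tree, the children of its root are equal and again
   have this property: by induction it is obtained from the single vertex by
   repeatedly taking [a] copies of the current tree as the children of a new root.
   Conversely, an isomorphism onto such a tree sends child subtrees to child
   subtrees, and counting vertices recovers the degree of the root.  Taking [a]
   copies turns m edges into (m + 1) * a edges, which is the recursion defining f,
   and the entries of the vector can be read off the tree as long as they are
   positive. *)
Require Import Defs.
From mathcomp Require Import all_boot.

Set Implicit Arguments.
Unset Strict Implicit.
Unset Printing Implicit Defensive.

Notation leaf := (PNode [::]).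

(** * Addresses of vertices, and isomorphisms as maps between them *)

Lemma is_childP a b : reflect (exists i, b = rcons a i) (is_child a b).
Proof.
apply: (iffP andP) => [[/prefixP[[|i [|j s]] ->]]|[i ->]].
- by rewrite cats0 => /eqP/n_Sn.
- by exists i; rewrite cats1.
- by rewrite size_cat -[X in _ == X]addn1 eqn_add2l.
- by rewrite prefix_rcons size_rcons.
Qed.

Lemma is_child_nil a : is_child a [::] = false.
Proof. by rewrite /is_child andbF. Qed.

Lemma is_child_rcons a b i : is_child a (rcons b i) = (a == b).
Proof.
apply/is_childP/eqP => [[j /rcons_inj[] ->]|->] //.
by exists i.
Qed.

(** The numbering starts at an arbitrary [m] because the tail of [ts] is numbered from [m.+1] in the
    induction. *)
Lemma mem_numbered_cat i b m (ts : seq plane_tree) :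
  (i :: b \in flatten [seq [seq ia.1 :: b | b <- ia.2]
                      | ia <- zip (iota m (size ts)) (map addresses ts)])
  = [&& m <= i, i - m < size ts & b \in addresses (nth leaf ts (i - m))].
Proof.
elim: ts m => [|t ts IHts] m /=; first by rewrite andbF.
rewrite mem_cat IHts.
have -> : (i :: b \in [seq m :: b | b <- addresses t])
          = (i == m) && (b \in addresses t).
  apply/mapP/andP => [[c tc [-> ->]]|[/eqP-> tb]]; first by rewrite eqxx.
  by exists b.
case: (ltngtP i m) => [//|lt_mi|->] /=; last by rewrite subnn orbF.
by rewrite -(subnSK lt_mi) /= ltnS.
Qed.

Lemma mem_addresses i b ts :
  (i :: b \in addresses (PNode ts))
  = (i < size ts) && (b \in addresses (nth leaf ts i)).
Proof. by rewrite /= in_cons /= mem_numbered_cat subn0. Qed.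

Lemma mem_addresses_catl a b t : a ++ b \in addresses t -> a \in addresses t.
Proof.
elim: a t => [|i a IHa] t; first by rewrite root_address.
case: t => ts; rewrite cat_cons !mem_addresses => /andP[-> /=].
exact: IHa.
Qed.

Lemma mem_addresses_rcons a i t :
  rcons a i \in addresses t -> a \in addresses t.
Proof. by rewrite -cats1; apply: mem_addresses_catl. Qed.

(** Working with a total map on sequences avoids membership proofs in terms. Only preservation of
    the child relation is asked; its reflection follows from injectivity. *)
Definition tree_iso (g : seq nat -> seq nat) (t t' : plane_tree) : Prop :=
  [/\ g [::] = [::],
      {in addresses t, forall a, g a \in addresses t'},
      {in addresses t &, injective g},
      {in addresses t', forall b, exists2 a, a \in addresses t & b = g a} &
      forall a i, rcons a i \in addresses t -> is_child (g a) (g (rcons a i))].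

Lemma tree_iso_underlying g t t' :
  tree_iso g t t' -> rooted_iso (underlying t) (underlying t').
Proof.
case=> g_nil g_mem g_inj g_surj g_child.
pose f (x : gvertex (underlying t)) : gvertex (underlying t') :=
  SeqSub (g_mem _ (valP x)).
have f_inj : injective f.
  by move=> x y [] /g_inj eq_xy; apply/val_inj/eq_xy; apply: valP.
have f_bij : bijective f.
  apply: (inj_card_bij f_inj); rewrite -(card_codom f_inj).
  apply/subset_leq_card/subsetP => y _; apply/codomP.
  have [a ta val_y] := g_surj _ (valP y).
  by exists (SeqSub ta); apply: val_inj.
(* Reflection: if [g y] is a child of [g x], then [y] is not the root, and [g] sends the parent of
   [y] to the parent of [g y], which is [g x]; by injectivity that parent is [x]. *)
have f_child (x y : seq_sub (addresses t)) :
    is_child (g (val x)) (g (val y)) = is_child (val x) (val y).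
  apply/idP/idP=> [|/is_childP[i eq_y]]; last first.
    by rewrite eq_y g_child // -eq_y; apply: valP.
  have ty := valP y; case/lastP: (val y) ty => [|b i] tb.
    by rewrite g_nil is_child_nil.
  have /is_childP[j ->] := g_child _ _ tb.
  rewrite !is_child_rcons => /eqP/g_inj-> //; first exact: valP.
  exact: mem_addresses_rcons tb.
exists f; split=> // [|x y]; first exact: val_inj.
by rewrite /= !f_child.
Qed.

(** Adjacency does not tell parent from child, so [f] might reverse an edge. Induction on depth
    excludes this: the parent of [f a] is already the image of the parent of [a], so no child of [a]
    can be sent there. *)
Lemma underlying_tree_iso t t' :
  rooted_iso (underlying t) (underlying t') -> exists g, tree_iso g t t'.
Proof.
case=> f [f_bij f_root f_adj].
have f_inj := bij_inj f_bij; have [f' _ fK'] := f_bij.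
pose g a := oapp (fun x : seq_sub (addresses t) => val (f x)) [::] (insub a).
have gE a (ta : a \in addresses t) : g a = val (f (SeqSub ta)).
  by rewrite /g insubT.
exists g; split.
- by rewrite (gE _ (root_address t)) f_root.
- by move=> a ta; rewrite gE; apply: valP.
- by move=> a b ta tb; rewrite !gE => /val_inj/f_inj[].
- move=> b tb; exists (val (f' (SeqSub tb))); first exact: valP.
  have tx := valP (f' (SeqSub tb)); rewrite (gE _ tx).
  have -> : SeqSub tx = f' (SeqSub tb) by apply: val_inj.
  by rewrite fK'.
have f_step a i (ta : a \in addresses t) (tai : rcons a i \in addresses t) :
    gadj (f (SeqSub ta)) (f (SeqSub tai)).
  by rewrite f_adj /= is_child_rcons eqxx.
elim/last_ind=> [|a j IHa] i tai; have ta := mem_addresses_rcons tai.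
all: have /orP[] := f_step _ _ ta tai; rewrite (gE _ ta) (gE _ tai) //.
  have -> : SeqSub ta = groot (underlying t) by apply: val_inj.
  by rewrite f_root is_child_nil.
have ta' := mem_addresses_rcons ta.
have := IHa _ ta; rewrite (gE _ ta) (gE _ ta') => /is_childP[k ->].
rewrite is_child_rcons => /eqP/val_inj/f_inj[] /(congr1 size).
by rewrite !size_rcons => /esym/eqP; rewrite ltn_eqF.
Qed.

(** * Rotating, replacing and extracting child subtrees *)

Lemma tree_iso_id t : tree_iso id t t.
Proof.
by split=> // [b tb|a i _]; [exists b | rewrite /= is_child_rcons].
Qed.

Lemma tree_iso_rot x s :
  exists g, tree_iso g (PNode (rcons s x)) (PNode (x :: s)).
Proof.
exists (fun a => if a is i :: b
                 then (if i == size s then 0 else i.+1) :: b else [::]).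
split=> //.
- case=> [|i b]; rewrite ?root_address // !mem_addresses size_rcons nth_rcons.
  by rewrite ltnS; case: ltngtP => //= lt_i; rewrite ltnS lt_i.
- move=> [|i a] [|j b] //; case: eqP => [->|_]; case: eqP => [->|_] //.
    by move=> _ _ [->].
  by move=> _ _ [-> ->].
- case=> [|[|i] b]; first by exists [::]; rewrite ?root_address.
    rewrite mem_addresses => /andP[_ xb]; exists (size s :: b).
      by rewrite mem_addresses size_rcons leqnn nth_rcons ltnn eqxx.
    by rewrite eqxx.
  rewrite mem_addresses ltnS => /andP[/= lt_i sb]; exists (i :: b).
    by rewrite mem_addresses size_rcons ltnW // nth_rcons lt_i.
  by rewrite ltn_eqF.
by case=> [|j a] i _; apply/is_childP; eexists; rewrite ?rcons_cons.
Qed.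

Lemma tree_iso_head g u u' s :
  tree_iso g u u' -> exists h, tree_iso h (PNode (u :: s)) (PNode (u' :: s)).
Proof.
case=> g_nil g_mem g_inj g_surj g_child.
exists (fun a => if a is 0 :: b then 0 :: g b else a); split=> //.
- case=> [|[|i] b] //; rewrite !mem_addresses //=; exact: g_mem.
- move=> [|[|i] a] [|[|j] b] //; rewrite !mem_addresses /=.
  by move=> ua ub [/g_inj->].
- case=> [|[|i] b]; first by exists [::]; rewrite ?root_address.
    rewrite mem_addresses => /andP[_ /g_surj[a ua ->]].
    by exists (0 :: a); rewrite // mem_addresses.
  by rewrite mem_addresses => sb; exists (i.+1 :: b); rewrite // mem_addresses.
case=> [|[|j] a] i; rewrite ?rcons_cons.
- by move=> _; apply/is_childP; case: i => [|i]; rewrite /= ?g_nil; eexists.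
- rewrite mem_addresses /= => /g_child/is_childP[k ->].
  by rewrite -rcons_cons is_child_rcons.
- by rewrite -rcons_cons is_child_rcons.
Qed.

(** All addresses through child [i] have images with the same first index [j]; deleting that index
    leaves an isomorphism of the subtrees. *)
Lemma tree_iso_child g ts ts' i :
    tree_iso g (PNode ts) (PNode ts') -> i < size ts ->
  exists2 j, j < size ts' &
    exists h, tree_iso h (nth leaf ts i) (nth leaf ts' j).
Proof.
case=> g_nil g_mem g_inj g_surj g_child lt_i.
have g_head k : k < size ts -> exists2 j, j < size ts' &
    forall b, b \in addresses (nth leaf ts k) ->
      g (k :: b) = j :: behead (g (k :: b)).
  move=> lt_k.
  have tk : [:: k] \in addresses (PNode ts).
    by rewrite mem_addresses lt_k root_address.
  have /is_childP[j] := g_child [::] k tk; rewrite g_nil /= => gk.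
  exists j; first by have := g_mem _ tk; rewrite gk mem_addresses => /andP[].
  elim/last_ind=> [|b l IHb] tkb; first by rewrite gk.
  have tkbl : rcons (k :: b) l \in addresses (PNode ts).
    by rewrite rcons_cons mem_addresses lt_k.
  have /is_childP[p] := g_child _ _ tkbl.
  by rewrite (IHb (mem_addresses_rcons tkb)) !rcons_cons => ->.
have [j lt_j gE] := g_head i lt_i; exists j => //.
have t_cons b :
    b \in addresses (nth leaf ts i) -> i :: b \in addresses (PNode ts).
  by rewrite mem_addresses lt_i.
exists (fun b => behead (g (i :: b))); split.
- have := g_child [::] i (t_cons _ (root_address _)).
  by rewrite g_nil => /is_childP[k ->].
- move=> b tb; have := g_mem _ (t_cons b tb).
  by rewrite gE // mem_addresses lt_j.
- move=> a b ta tb eq_ab; suff [] : i :: a = i :: b by [].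
  by apply: g_inj; rewrite ?t_cons // (gE a) // (gE b) // eq_ab.
- move=> b tb; have tjb : j :: b \in addresses (PNode ts').
    by rewrite mem_addresses lt_j.
  have [[|k a]] := g_surj _ tjb; first by rewrite g_nil.
  rewrite mem_addresses => /andP[lt_k ta] def_g.
  have [j' _ gE'] := g_head k lt_k.
  have eq_j : j' = j by move: def_g; rewrite gE' // => -[].
  (* Both [[:: k]] and [[:: i]] are sent to the child [[:: j]] of the root, so [g] being injective
     identifies them. *)
  have eq_k : k = i.
    suff [] : [:: k] = [:: i] by [].
    have nil_g l : l < size ts -> is_child [::] (g [:: l]).
      move=> lt_l; have := g_child [::] l; rewrite g_nil; apply.
      by rewrite mem_addresses lt_l root_address.
    apply: g_inj; rewrite ?mem_addresses ?lt_k ?lt_i ?root_address //.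
    have := nil_g _ lt_k; have := nil_g _ lt_i.
    rewrite (gE _ (root_address _)) (gE' _ (root_address _)) eq_j.
    by move=> /is_childP[p [_ ->]] /is_childP[q [_ ->]].
  by exists a; rewrite -eq_k // -def_g.
move=> b k tbk; have tb := mem_addresses_rcons tbk.
have := g_child (i :: b) k; rewrite rcons_cons => /(_ (t_cons _ tbk)).
rewrite gE // => /is_childP[l ->].
by rewrite /= is_child_rcons.
Qed.

(** * The underlying graph is a tree, and its edges *)

Section UnderlyingTree.
Variable t : plane_tree.
Let V := gvertex (underlying t).
Implicit Types (x y c : V) (p q : seq V).

Lemma underlying_sym : symmetric (@gadj (underlying t)).
Proof. by move=> x y; apply: orbC. Qed.

Lemma underlying_irr : irreflexive (@gadj (underlying t)).
Proof. by move=> x; rewrite /= orbb /is_child (ltn_eqF (ltnSn _)) andbF. Qed.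

(* The edge joining [c] to its parent [x] is the only way out of the set of
   descendants of [c]. *)
Lemma gadj_leave (u v c x : V) :
    gadj u v -> prefix (val c) (val u) -> ~~ prefix (val c) (val v) ->
    is_child (val x) (val c) ->
  u = c /\ v = x.
Proof.
move=> /orP[] /is_childP[i def_i] cu cv.
  by move: cv; rewrite def_i (prefix_trans cu) // prefix_rcons.
move: cu; rewrite def_i => /prefixP[s].
case/lastP: s => [|s j]; last first.
  rewrite -rcons_cat => /rcons_inj[ev _].
  by rewrite (ev : val v = _) prefix_prefix in cv.
rewrite cats0 => ec; rewrite -ec is_child_rcons => /eqP/val_inj->.
by split=> //; apply: val_inj; rewrite def_i.
Qed.

(** A path avoiding the parent [x] of [c] never uses the edge between [x] and [c], so it stays
    inside or outside the descendants of [c]. *)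
Lemma prefix_last (w c x : V) p :
    path (@gadj (underlying t)) w p -> is_child (val x) (val c) ->
    x \notin w :: p ->
  prefix (val c) (val (last w p)) = prefix (val c) (val w).
Proof.
move=> + xc; elim: p w => [|v p IHp] w //= /andP[wv vp].
rewrite inE negb_or => /andP[x_w x_vp]; rewrite (IHp _ vp x_vp).
have x_v : v != x by move: x_vp; rewrite inE negb_or eq_sym => /andP[].
have vw : gadj v w by rewrite underlying_sym.
have := gadj_leave vw _ _ xc; have := gadj_leave wv _ _ xc.
case: (prefix _ (val w)); case: (prefix _ (val v)) => // H1 H2.
  by case: H1 => // _ /eqP; rewrite (negPf x_v).
by case: H2 => // _ /eqP; rewrite eq_sym (negPf x_w).
Qed.

Lemma underlying_connect x : connect (@gadj (underlying t)) (groot _) x.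
Proof.
case: x => a; elim/last_ind: a => [|a i IHa] ta.
  by rewrite (_ : SeqSub ta = groot (underlying t)) //; apply: val_inj.
apply: connect_trans (IHa (mem_addresses_rcons ta)) (connect1 _).
by rewrite /= is_child_rcons eqxx.
Qed.

(** The first path goes down to [c] and never returns to [x], so the common end lies below [c]. The
    second path avoids [x] after its first step, so [d] also lies below [c]; being adjacent to [x],
    it is [c]. *)
Lemma simple_path_step (c d x : V) p q :
    path (@gadj (underlying t)) x (c :: p) -> uniq (x :: c :: p) ->
    path (@gadj (underlying t)) x (d :: q) -> uniq (x :: d :: q) ->
    is_child (val x) (val c) -> last c p = last d q ->
  c = d.
Proof.
move=> /= /andP[_ cp] /andP[x_cp _] /andP[xd dq] /andP[x_dq _] xc eq_last.
have := prefix_last dq xc x_dq.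
rewrite -eq_last (prefix_last cp xc x_cp) prefix_refl => cd.
have dx : gadj d x by rewrite underlying_sym.
have [] // := gadj_leave dx _ _ xc.
have szc : size (val c) = (size (val x)).+1 by case/andP: xc => _ /eqP.
by apply/negP => /size_prefix; rewrite szc ltnn.
Qed.

Lemma simple_path_unique (x : V) p q :
    path (@gadj (underlying t)) x p -> uniq (x :: p) ->
    path (@gadj (underlying t)) x q -> uniq (x :: q) ->
    last x p = last x q ->
  p = q.
Proof.
elim: p q x => [|c p IHp] [|d q] x // xp Up xq Uq eq_last.
- by move: Uq; rewrite /= -[x]/(last x [::]) eq_last /= mem_last.
- by move: Up; rewrite /= -[x in x \notin _]/(last x [::]) -eq_last /= mem_last.
have eq_cd : c = d.
  have /orP[xc|cx] : gadj x c by case/andP: xp.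
    exact: simple_path_step xp Up xq Uq xc eq_last.
  have /orP[xd|dx] : gadj x d by case/andP: xq.
    exact/esym/(simple_path_step xq Uq xp Up xd).
  (* Both paths start upwards here, and a vertex has only one parent. *)
  case/is_childP: cx dx => i ->; rewrite is_child_rcons => /eqP.
  by move/val_inj.
rewrite -eq_cd in xq Uq eq_last *; congr (_ :: _).
case/andP: xp => _ cp; case/andP: xq => _ cq.
by apply: IHp cp _ cq _ eq_last; [case/andP: Up | case/andP: Uq].
Qed.

Lemma underlying_rooted_tree : rooted_tree (underlying t).
Proof.
split; [exact: underlying_sym | exact: underlying_irr | move=> x y].
have /connectP[p0 xp0 ->] : connect (@gadj (underlying t)) x y.
  apply: connect_trans (underlying_connect y).
  by rewrite (sym_connect_sym underlying_sym) underlying_connect.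
case/shortenP: xp0 => p xp Up _; exists p; split=> // q [xq Uq eq_last].
by apply: simple_path_unique xp Up xq Uq _.
Qed.

(** Each edge is matched with its lower end, which can be any vertex except the root. *)
Lemma num_edges_underlying : num_edges (underlying t) = #|V|.-1.
Proof.
pose parent (x : V) : V :=
  insubd (groot (underlying t)) (rev (behead (rev (val x)))).
have parentE a i (ta : a \in addresses t) (tai : rcons a i \in addresses t) :
    parent (SeqSub tai) = SeqSub ta.
  by apply: val_inj; rewrite /parent /= rev_rcons /= revK val_insubd ta.
have par_child (x : V) : x != groot _ -> is_child (val (parent x)) (val x).
  case: x => a; case/lastP: a => [|a i] ta; first by case/eqP; apply: val_inj.
  by move=> _; rewrite (parentE _ _ (mem_addresses_rcons ta)) /= is_child_rcons.
rewrite /num_edges -(cardC1 (groot (underlying t))).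
rewrite -(card_in_imset (f := fun x : V => [set parent x; x])); last first.
  (* Distinct [x] and [y] giving the same edge would be parents of each other, against the lengths
     of their addresses. *)
  move=> x y; rewrite !inE => x_root y_root eq_xy.
  have : x \in [set parent y; y] by rewrite -eq_xy set22.
  rewrite !inE => /orP[/eqP def_x|/eqP//].
  have : y \in [set parent x; x] by rewrite eq_xy set22.
  rewrite !inE => /orP[/eqP def_y|/eqP//].
  have /andP[_ /eqP szx] := par_child _ x_root.
  have /andP[_ /eqP szy] := par_child _ y_root.
  rewrite -def_x -def_y in szx szy.
  by move/eqP: szx; rewrite szy ltn_eqF // ltnS leqnSn.
apply: eq_card => e; apply/imsetP/imsetP => [[[x y]]|[x x_root ->]]; last first.
  exists (parent x, x) => //; rewrite inE /= par_child //.
have gen (u v : V) : is_child (val u) (val v) ->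
    exists2 z, z \in predC1 (groot (underlying t)) &
      [set u; v] = [set parent z; z].
  move=> uv; have v_root : v != groot (underlying t).
    by apply: contraTneq uv => ->; rewrite is_child_nil.
  exists v => //; congr [set _; v]; apply: val_inj.
  case/is_childP: (uv) => i def_v; have := par_child _ v_root.
  by rewrite def_v is_child_rcons => /eqP.
rewrite inE => /orP[] /= xy ->; first exact: gen.
by rewrite setUC; apply: gen.
Qed.

End UnderlyingTree.

(** * Rooted isomorphism as an equivalence that preserves the number of edges *)

Lemma rooted_iso_sym G H : rooted_iso G H -> rooted_iso H G.
Proof.
case=> f [f_bij f_root f_adj]; have [g fK gK] := f_bij.
exists g; split; first by exists f.
  by rewrite -f_root fK.
by move=> x y; rewrite -f_adj !gK.
Qed.

Lemma rooted_iso_trans G H K :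
  rooted_iso G H -> rooted_iso H K -> rooted_iso G K.
Proof.
case=> f [f_bij f_root f_adj] [g [g_bij g_root g_adj]].
exists (g \o f); split; first exact: bij_comp.
  by rewrite /= f_root.
by move=> x y; rewrite /= g_adj f_adj.
Qed.

Lemma rooted_iso_num_edges G H : rooted_iso G H -> num_edges G = num_edges H.
Proof.
case=> f [f_bij f_root f_adj]; have f_inj := bij_inj f_bij.
rewrite /num_edges -(card_imset _ (imset_inj f_inj)).
have [g _ gK] := f_bij; apply: eq_card => e.
apply/imsetP/imsetP => [[_ /imsetP[[x y] xy ->] ->]|[[x y] xy ->]].
  exists (f x, f y); last by rewrite imsetU1 imset_set1.
  by move: xy; rewrite !inE /= f_adj.
exists [set g x; g y]; last by rewrite imsetU1 imset_set1 !gK.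
apply/imsetP; exists (g x, g y) => //.
by move: xy; rewrite !inE /= -f_adj !gK.
Qed.

(** * Trees built from vectors *)

Definition sym_tree (A : seq nat) : plane_tree :=
  foldl (fun u a => PNode (nseq a u)) leaf A.

Lemma sym_tree_rcons A a : sym_tree (rcons A a) = PNode (nseq a (sym_tree A)).
Proof. by rewrite /sym_tree foldl_rcons. Qed.

(* The junk value 0 at [::] is what makes this hold for every A. *)
Lemma vec_valE A : vec_val A = foldl (fun m b => m.+1 * b) 0 A.
Proof. by case: A => //= a s; rewrite mul1n. Qed.

Lemma size_addresses_nseq a u :
  size (addresses (PNode (nseq a u))) = (a * size (addresses u)).+1.
Proof.
rewrite /= size_nseq; congr _.+1; elim: a 0 => //= a IHa m.
by rewrite size_cat size_map IHa mulSn.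
Qed.

Lemma uniq_addresses_nseq a u :
  uniq (addresses u) -> uniq (addresses (PNode (nseq a u))).
Proof.
move=> Uu; rewrite /=; apply/andP; split.
  apply/flattenP => -[_ /mapP[ia _ ->] ].
  by case/mapP.
rewrite size_nseq; elim: a 0 => //= a IHa m.
rewrite cat_uniq map_inj_uniq; last by move=> b c [].
rewrite Uu IHa andbT /=; apply/hasPn => -[|i b].
  by move=> _; apply/mapP => -[].
move=> ib; apply/mapP => -[c _ [def_i _]]; move: ib; rewrite def_i.
by rewrite -{1}(size_nseq a u) mem_numbered_cat ltnn.
Qed.

(** Addresses are listed without repetition, so vertices are counted by the length of the list; [a]
    copies under a new root turn [m + 1] entries into [(m + 1) * a + 1]. *)
Lemma card_sym_tree A : #|gvertex (underlying (sym_tree A))| = (vec_val A).+1.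
Proof.
have [Us sz] : uniq (addresses (sym_tree A))
    /\ size (addresses (sym_tree A)) = (vec_val A).+1.
  rewrite vec_valE; elim/last_ind: A => [|A a [Us sz]] //.
  rewrite sym_tree_rcons foldl_rcons; split; first exact: uniq_addresses_nseq.
  by rewrite size_addresses_nseq sz mulnC.
by rewrite -sz -(card_seq_sub Us).
Qed.

Lemma num_edges_sym_tree A : num_edges (underlying (sym_tree A)) = vec_val A.
Proof. by rewrite num_edges_underlying card_sym_tree. Qed.

(** The degree of the root gives the last entry. Since it is positive, a child is available from
    which the earlier entries are read; an entry 0 would erase them. *)
Lemma sym_tree_inj A B :
  all (leq 1) A -> all (leq 1) B -> sym_tree A = sym_tree B -> A = B.
Proof.
elim/last_ind: A B => [|A a IHA] B; case/lastP: B => [|B b] //.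
- by rewrite sym_tree_rcons all_rcons => _ /andP[]; case: b.
- by rewrite sym_tree_rcons all_rcons => /andP[]; case: a.
rewrite !all_rcons !sym_tree_rcons => /andP[a_gt0 posA] /andP[_ posB] [eq_n].
have eq_ab : a = b by have := congr1 size eq_n; rewrite !size_nseq.
congr rcons => //; apply: IHA => //.
by have := congr1 (head leaf) eq_n; rewrite -eq_ab; case: (a) a_gt0.
Qed.

(** * Plane trees that are the only realization of their rooted tree *)

Definition rigid (t : plane_tree) : Prop :=
  forall t', rooted_iso (underlying t') (underlying t) -> t' = t.

Lemma card_iso t t' : rooted_iso (underlying t) (underlying t') ->
  #|gvertex (underlying t)| = #|gvertex (underlying t')|.
Proof. by case=> f [/bij_eq_card]. Qed.

Lemma sym_tree_rigid A : rigid (sym_tree A).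
Proof.
elim/last_ind: A => [|A a IHA] [ts] iso_t.
  have [g g_iso] := underlying_tree_iso iso_t.
  case: ts {iso_t} g_iso => [//|u s] g_iso.
  by have [] := tree_iso_child g_iso (ltn0Sn _).
have := card_iso iso_t; rewrite sym_tree_rcons in iso_t *.
have [g g_iso] := underlying_tree_iso iso_t.
(* Each child of the root is isomorphic to some child of the target, and all of those are
   [sym_tree A], which is rigid by induction. *)
have -> : ts = nseq (size ts) (sym_tree A).
  apply: (@eq_from_nth _ leaf) => [|i lt_i]; first by rewrite size_nseq.
  have [j + [h]] := tree_iso_child g_iso lt_i.
  rewrite size_nseq !nth_nseq lt_i => -> /tree_iso_underlying.
  exact: IHA.
(* Equal vertex counts now give [size ts = a]: the common factor is a successor and cancels. *)
rewrite -!sym_tree_rcons !card_sym_tree !vec_valE !foldl_rcons => -[].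
by move/eqP; rewrite eqn_pmul2l // => /eqP->.
Qed.

(** Rigidity under rotation gives [rcons s u = u :: s], so each child equals the one before it. *)
Lemma rigid_nseq u s : rigid (PNode (u :: s)) -> s = nseq (size s) u.
Proof.
move=> t_rigid; have [g g_iso] := tree_iso_rot u s.
have [] := t_rigid _ (tree_iso_underlying g_iso).
elim: s {t_rigid g g_iso} => //= v s IHs [-> /IHs eq_s].
by rewrite {1}eq_s.
Qed.

Lemma rigid_head u s : rigid (PNode (u :: s)) -> rigid u.
Proof.
move=> t_rigid u' /underlying_tree_iso[g /(@tree_iso_head _ _ _ s)[h h_iso]].
by have [] := t_rigid _ (tree_iso_underlying h_iso).
Qed.

Lemma rigid_sym_tree t : rigid t -> exists2 A, all (leq 1) A & t = sym_tree A.
Proof.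
(* The recursion is on the first child, a subtree nested in a list, hence the explicit [fix]. *)
move: t; fix IHt 1; case=> -[|u s] t_rigid; first by exists [::].
have [A posA def_u] := IHt u (rigid_head t_rigid).
exists (rcons A (size s).+1); first by rewrite all_rcons.
by rewrite sym_tree_rcons -def_u /= -(rigid_nseq t_rigid).
Qed.

(** * Listing the vectors of given value, and the count *)

Lemma complexity_enum n : 0 < n ->
  exists L : seq (seq nat), [/\ size L = complexity n, uniq L &
    forall A, (A \in L) = all (leq 1) A && (vec_val A == n)].
Proof.
move=> n_gt0.
pose S k := [set A : k.-tuple 'I_n.+1 |
  all (fun a : 'I_n.+1 => 0 < a) A
  && (vec_val [seq val a | a : 'I_n.+1 <- A] == n)].
exists [seq map val (val A) | k <- index_iota 1 n.+1, A <- enum (S k)].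
split.
- rewrite size_allpairs_dep sumnE big_map; apply: eq_bigr => k _.
  by rewrite -cardE.
- apply: allpairs_uniq_dep => [||[k A] [l B] _ _ /= eq_AB].
  + exact: iota_uniq.
  + by move=> k _; apply: enum_uniq.
  (* The length of a vector recovers the index [k], so different lengths contribute disjoint
     families. *)
  have eq_kl : k = l.
    by rewrite -(size_tuple A) -(size_tuple B) -(size_map val) eq_AB size_map.
  case: l / eq_kl B eq_AB => B /(inj_map val_inj)/val_inj-> //.
move=> A; apply/allpairsPdep/andP => [[k [B [_]]]|[posA /eqP valA]].
  rewrite mem_enum inE => /andP[posB valB] ->; split=> //.
  by rewrite all_map.
have [szA leA] := vec_bounds posA; rewrite valA in szA leA.
have def_A : map val [seq inord a : 'I_n.+1 | a <- A] = A.
  rewrite -map_comp -[RHS]map_id; apply/eq_in_map => a /(allP leA) le_an.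
  by rewrite /= inordK.
have szB : size [seq inord a : 'I_n.+1 | a <- A] == size A by rewrite size_map.
exists (size A), (Tuple szB); split=> //.
  (* The lengths start at 1; the empty vector is excluded because its value 0 differs from [n]. *)
  rewrite mem_index_iota ltnS szA andbT lt0n size_eq0.
  by apply: contraTneq n_gt0 => A0; rewrite -valA A0.
rewrite mem_enum inE /= def_A valA eqxx andbT.
by move: posA; rewrite -{1}def_A all_map.
Qed.

Theorem theorem1 (n : nat) (n_ge1 : 1 <= n) :
  count_upto rooted_iso
    (fun G : rooted_graph =>
       [/\ rooted_tree G, absolutely_symmetric G & num_edges G = n])
    (complexity n).
Proof.
have [L [<- UL memL]] := complexity_enum n_ge1.
have memP (i : 'I_(size L)) :
    all (leq 1) (nth [::] L i) /\ vec_val (nth [::] L i) = n.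
  by have := mem_nth [::] (ltn_ord i); rewrite memL => /andP[? /eqP].
exists (fun i => underlying (sym_tree (nth [::] L i))); split.
- move=> i; have [posA valA] := memP i; split.
  + exact: underlying_rooted_tree.
  + exists (sym_tree (nth [::] L i)); split=> [|t' /sym_tree_rigid //].
    exact: tree_iso_underlying (tree_iso_id _).
  + by rewrite num_edges_sym_tree.
(* Rigidity turns an isomorphism of representatives into an equality of plane trees, and the vectors
   are then equal. *)
- move=> i j /sym_tree_rigid eq_ij.
  have [[posi _] [posj _]] := (memP i, memP j).
  apply/val_inj/eqP; rewrite -(nth_uniq [::] (ltn_ord i) (ltn_ord j) UL).
  exact/eqP/(sym_tree_inj _ _ eq_ij).
move=> G [_ [t [t_iso t_uniq]] edgesG].
(* A realization of the rooted tree of [t] also realizes [G], so uniqueness for [G] makes [t]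
   rigid. *)
have [t' t'_iso|A posA def_t] := @rigid_sym_tree t.
  by apply/esym/t_uniq; apply: rooted_iso_trans t'_iso t_iso.
rewrite def_t in t_iso.
have LA : A \in L.
  rewrite memL posA -num_edges_sym_tree.
  by rewrite (rooted_iso_num_edges t_iso) edgesG eqxx.
rewrite -index_mem in LA; exists (Ordinal LA) => /=.
by rewrite nth_index -?index_mem //; apply: rooted_iso_sym.
Qed.
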